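(* For every $\eta \in (0,1)$ there exists $c_\eta > 0$ depending only on $\eta$ such that, for every $p \geq 1$ and every $\mu \in \mathbb{R}^p$ with $\mu_1 \geq \dots \geq \mu_p > 0$ satisfying $$\max_{1 \leq j \leq p} \mu_j h^{-1}\left(\frac{\log(ej)}{\mu_j}\right) \geq 1,$$ one has $$\mathcal{R}_{\mathcal{P}}\left(c_\eta \max_{1 \leq j \leq p} \mu_j h^{-1}\left(\frac{\log(ej)}{\mu_j}\right), \mu\right) \geq \eta.$$
   Context: $h : [-1,\infty) \to \mathbb{R}$ is defined by $h(-1) = 1$ and $h(x) = (1+x)\log(1+x) - x$ for $x > -1$; $h^{-1} : [0,\infty) \to [0,\infty)$ denotes the inverse of $h$ restricted to $[0,\infty)$. For $\lambda \in [0,\infty)^p$, $P_\lambda$ denotes the law of $X = (X_1,\dots,X_p)$ with independent coordinates $X_j \sim \mathrm{Poisson}(\lambda_j)$. For $\varepsilon > 0$, $\Lambda(\mu,\varepsilon) = \{\lambda \in [0,\infty)^p : \|\mu - \lambda\|_\infty \geq \varepsilon\}$, where $\|v\|_\infty = \max_{1 \leq j \leq p}|v_j|$. The minimax testing risk is $$\mathcal{R}_{\mathcal{P}}(\varepsilon,\mu) = \inf_{\varphi}\left\{P_\mu\{\varphi = 1\} + \sup_{\lambda \in \Lambda(\mu,\varepsilon)} P_\lambda\{\varphi = 0\}\right\},$$ where the infimum is over all tests, i.e. measurable $\{0,1\}$-valued functions $\varphi = \varphi(X)$ of the data. *)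

(* Defs.v *)
From HB Require Import structures.
From mathcomp Require Import all_boot all_order all_algebra.
From mathcomp Require Import all_classical all_reals all_analysis.

Set Implicit Arguments.
Unset Strict Implicit.
Unset Printing Implicit Defensive.

Import Order.TTheory GRing.Theory Num.Theory.
Import numFieldNormedType.Exports.

Local Open Scope classical_set_scope.
Local Open Scope ring_scope.

(* Law on n-tuples of independent coordinates, the i-th having law P i; the
   product formula that characterizes it is product_lawE. *)
Section product_law.
Context d (T : measurableType d) (R : realType).

Definition cons_pair n (x : T * n.-tuple T) : n.+1.-tuple T :=
  [tuple of x.1 :: x.2].

Let measurable_cons_pair n : measurable_fun setT (@cons_pair n).
Proof. exact: measurable_cons. Qed.

HB.instance Definition _ n :=
  isMeasurableFun.Build _ _ _ _ (@cons_pair n) (@measurable_cons_pair n).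

Fixpoint product_law n : ('I_n -> probability T R) -> probability (n.-tuple T) R :=
  match n with
  | 0 => fun=> \d_[tuple]
  | n'.+1 => fun P => distribution
      (P ord0 \x product_law (fun i => P (lift ord0 i)))%E (@cons_pair n')
  end.

Lemma product_lawE n (P : 'I_n -> probability T R) (B : 'I_n -> set T) :
  (forall i, measurable (B i)) ->
  product_law P [set x | forall i, B i (tnth x i)] = (\prod_i P i (B i))%E.
Proof.
elim: n P B => [|n IH] P B mB.
  rewrite big_ord0 /= diracE mem_set//; by case.
rewrite big_ord_recl /= /distribution /pushforward.
rewrite -IH//.
set A := (X in product_law _ X).
have mA : measurable A.
  rewrite (_ : A = \bigcap_i ((fun x => tnth x i) @^-1` (B (lift ord0 i)))).
    apply: fin_bigcap_measurable => // i _.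
    by rewrite -[X in measurable X]setTI; exact: measurable_tnth.
  by apply/seteqP; split => x /= h i => [_|]; exact: h.
rewrite -product_measure1E//; congr (_ _).
apply/seteqP; split => -[x y] /=.
  move=> h; split => [|i]; first by have := h ord0.
  by have := h (lift ord0 i); rewrite tnthS.
move=> [h0 h1] i; case: (unliftP ord0 i) => [j|] ->; last by [].
by rewrite tnthS; exact: h1.
Qed.

End product_law.

Section poisson_testing.
Context {R : realType}.

Definition h (x : R) : R :=
  if x == -1 then 1 else (1 + x) * ln (1 + x) - x.

Definition h_inv : R -> R := 'pinv_(fun=> 0) `[0, +oo[%classic h.

(* The nat argument of poisson_prob is a dummy (its value does not occur in the
   definition); at rate 0 poisson_prob is the Dirac mass at 0. *)
Definition poisson_law p (lam : 'rV[R]_p) : probability (p.-tuple nat) R :=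
  product_law (fun j => poisson_prob (lam ord0 j) 0 : probability nat R).

(* The norm on row vectors is the maximum of the absolute values of the
   entries. *)
Definition alternative p (mu : 'rV[R]_p) (eps : R) : set 'rV[R]_p :=
  [set lam : 'rV[R]_p | (forall j, 0 <= lam ord0 j) /\ eps <= `|mu - lam|].

Definition minimax_risk p (eps : R) (mu : 'rV[R]_p) : \bar R :=
  ereal_inf (range (fun phi : {mfun p.-tuple nat >-> bool} =>
    poisson_law mu [set x | phi x = true] +
    ereal_sup [set poisson_law lam [set x | phi x = false]
              | lam in alternative mu eps])%E).

(* Coordinates are numbered from 0, hence log (e j) becomes ln (e j.+1). The
   terms are nonnegative when mu has positive entries, so for p > 0 the default
   value 0 does not affect the maximum. *)
Definition critical_radius p (mu : 'rV[R]_p) : R :=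
  \big[Num.max/0]_(j < p)
    (mu ord0 j * h_inv (ln (expR 1 * j.+1%:R) / mu ord0 j)).

End poisson_testing.

(* Main.v *)
Require Import Defs.
From mathcomp Require Import all_boot all_order all_algebra.
From mathcomp Require Import all_classical all_reals all_analysis.
From mathcomp Require Import measurable_realfun ring lra.

Set Implicit Arguments.
Unset Strict Implicit.
Unset Printing Implicit Defensive.

Import Order.TTheory GRing.Theory Num.Theory.
Import numFieldNormedType.Exports.
Local Open Scope ring_scope.

(** The law [P_mu] cannot be told apart from the average, over the [k] largest
rates, of the laws obtained by adding [eps] to a single rate [mu_i]; here [k]
is the index where the maximum [M] defining the critical radius is reached and
[eps = c M].  Two facts carry the proof.

Information.  The Kullback-Leibler divergence between the Poisson laws of rates
[mu_i + eps] and [mu_i] is [mu_i h (eps / mu_i)] ([poisson_kl]).  Convexity of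
[h] with [h 0 = 0] gives [h (t x) <= t h x] for [t] in [[0, 1]], and since
[mu_i >= mu_k] and [h (h_inv y) = y], each of these divergences is at most
[c log (e k)] ([perspective_h_le]).

Mixture.  Whatever the coordinate laws are, [k] single-coordinate perturbations
of divergence at most [c log (e k)] each are undetectable when [c] is small
([sparse_mixture_bound]).  The second moment of a likelihood ratio [L_i] may be
far too large, so [L_i] is replaced by [V_i], equal to [L_i] where
[L_i <= t] and to 0 elsewhere, with [t = e^2 sqrt k].  With
[psi y = y ln y - y + 1], whose mean at [L_i] is the divergence, two pointwise
inequalities suffice:
- [(ln t - 1) y <= (ln t - 1) y 1_(y <= t) + psi y], so that
  [E V_i >= 1 - 2 c], because [ln t - 1 >= ln (e k) / 2];
- [(y 1_(y <= t))^2 + 1 <= 2 y + 4 t psi y], so that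
  [E V_i^2 <= 1 + 4 t c ln (e k)].
The cross moments satisfy [E V_i V_j <= E L_i L_j = 1], hence the average [W] of
the [V_i] satisfies [E W^2 <= 1 + 4 t c ln (e k) / k <= 1 + 8 e^2 c]: it is
within [O(sqrt c)] of 1 in mean square.  For any test the two errors then add up
to at least [E min(1, W)], which is [1 - O(sqrt c)]. *)

(** * The function h and truncated likelihood ratios *)

(** The integrand of the Kullback-Leibler divergence at a likelihood ratio [y]:
the terms [- y + 1] have mean zero and make it pointwise nonnegative. *)
Definition entropy {R : realType} (y : R) : R := y * ln y - y + 1.

Section entropy.
Context {R : realType}.
Implicit Types s t x y z T : R.

Lemma hE x : 0 <= x -> h x = (1 + x) * ln (1 + x) - x.
Proof. by move=> x0; rewrite /h ifF//; apply/eqP; lra. Qed.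

Lemma ln_ge_1subV x : 0 < x -> 1 - x^-1 <= ln x.
Proof.
move=> x0; have xi0 : 0 < x^-1 by rewrite invr_gt0.
have := @le_ln1Dx R (x^-1 - 1) ltac:(lra).
by rewrite (_ : 1 + (x^-1 - 1) = x^-1) ?lnV ?posrE//; [lra|ring].
Qed.

(** The tangent line of the convex function [y ln y] at [expR s] (equivalently,
Fenchel's inequality). *)
Lemma mulr_ln_ge s y : 0 < y -> y * s + y - expR s <= y * ln y.
Proof.
move=> y0; have e0 := expR_gt0 s.
have := ln_ge_1subV (divr_gt0 y0 e0).
rewrite ln_div ?posrE// expRK invf_div => H.
have := ler_wpM2l (ltW y0) H.
have -> : y * (1 - expR s / y) = y - expR s by field; lra.
lra.
Qed.

(** [h] is convex and vanishes at 0.  Concretely, the tangent to [y ln y] at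
[1 + t x] is compared with the function at [1 + x] and at 1, with weights [t]
and [1 - t]. *)
Lemma h_mul_le t x : 0 <= t <= 1 -> 0 <= x -> h (t * x) <= t * h x.
Proof.
move=> /andP[t0 t1] x0.
have tx0 : 0 <= t * x by apply: mulr_ge0.
rewrite !hE//; set s := ln (1 + t * x).
have es : expR s = 1 + t * x by rewrite lnK// posrE; lra.
have H1 := @mulr_ln_ge s (1 + x) ltac:(lra).
have H2 := @mulr_ln_ge s 1 ltac:(lra).
rewrite ln1 in H2; rewrite es in H1 H2.
have := ler_wpM2l t0 H1.
have := ler_wpM2l (_ : 0 <= 1 - t) H2.
move=> /(_ ltac:(lra)).
nra.
Qed.

(** Linear growth of [h], so that it takes arbitrarily large values. *)
Lemma h_ge_sub x : 0 <= x -> x - expR 1 <= h x.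
Proof.
move=> x0; rewrite hE//; have := @mulr_ln_ge 1 (1 + x) ltac:(lra); lra.
Qed.

Lemma h_invP z : 0 <= z -> 0 <= h_inv z /\ h (h_inv z) = z.
Proof.
move=> z0.
have zim : z \in ((@h R) @` `[0, +oo[)%classic.
  have e0 := expR_gt0 (1 : R).
  have [| | |x] := @IVT R (fun x => (1 + x) * ln (1 + x) - x) 0 (z + expR 1) z.
  - lra.
  - apply: continuous_in_subspaceT => x; rewrite inE/= in_itv/= => /andP[x0 _].
    have x1 : 0 < 1 + x by lra.
    have cx : {for x, continuous (fun x : R => 1 + x)}.
      by apply: cvgD; [exact: cvg_cst|exact: cvg_id].
    apply: cvgB; last exact: cvg_id.
    apply: cvgM => //.
    by apply: (@continuous_comp _ _ _ (fun x : R => 1 + x) (@ln R)) => //;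
      exact: continuous_ln.
  - have := @h_ge_sub (z + expR 1) ltac:(lra); rewrite hE; last lra.
    rewrite addr0 ln1 mulr0 subr0 => H.
    by rewrite ge_min z0/= le_max; apply/orP; right; lra.
  - rewrite in_itv/= => /andP[x0 _] xz; rewrite inE/=; exists x.
      by rewrite in_itv/= x0.
    by rewrite hE.
split; last exact: pinvK.
suff : (`[0, +oo[%classic (h_inv z : R)) by rewrite /= in_itv/= andbT.
move: zim; rewrite inE => zim.
by rewrite /h_inv /pinv_ splitV; case: oinvP.
Qed.

(** The pointwise form of the domination of the squared Hellinger distance by
the divergence; it follows from [ln y = 2 ln (sqrt y) >= 2 (1 - 1 / sqrt y)]. *)
Lemma entropy_ge_sqrt y : 0 <= y -> (Num.sqrt y - 1) ^+ 2 <= entropy y.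
Proof.
rewrite /entropy le_eqVlt => /predU1P[<-|y0]; first by rewrite sqrtr0 mul0r; lra.
have s0 : 0 < Num.sqrt y by rewrite sqrtr_gt0.
have ys : y = Num.sqrt y ^+ 2 by rewrite sqr_sqrtr// ltW.
have lns : ln y = 2 * ln (Num.sqrt y) by rewrite {1}ys lnXn// mulr_natl.
rewrite lns {2 4}ys; move: (Num.sqrt y) s0 => s s0.
have := ler_wpM2l (_ : 0 <= 2 * s ^+ 2) (ln_ge_1subV s0).
rewrite (_ : 2 * s ^+ 2 * (1 - s^-1) = 2 * s ^+ 2 - 2 * s); last by field; lra.
by move=> /(_ ltac:(nra)); lra.
Qed.

Lemma entropy_ge0 y : 0 <= y -> 0 <= entropy y.
Proof. by move=> y0; apply: le_trans (entropy_ge_sqrt y0); exact: sqr_ge0. Qed.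

Definition truncate T y : R := if y <= T then y else 0.

Lemma truncate_ge0 T y : 0 <= y -> 0 <= truncate T y.
Proof. by move=> y0; rewrite /truncate; case: ifP. Qed.

Lemma truncate_le T y : 0 <= y -> truncate T y <= y.
Proof. by move=> y0; rewrite /truncate; case: ifP. Qed.

(** Where the truncation is inactive this says [(y - 1)^2 <= 4 T entropy y]; it
follows from [entropy_ge_sqrt] and [(sqrt y + 1)^2 <= 4 T], valid for [y <= T] and
[1 <= T].  Where it is active, [2 y >= 1]. *)
Lemma truncate_sqr_le T y : 1 <= T -> 0 <= y ->
  truncate T y ^+ 2 + 1 <= 2 * y + 4 * T * entropy y.
Proof.
move=> T1 y0; have e0 := entropy_ge0 y0.
rewrite /truncate; case: (leP y T) => yT; last by nra.
suff : (y - 1) ^+ 2 <= 4 * T * entropy y by lra.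
have s0 : 0 <= Num.sqrt y by exact: sqrtr_ge0.
have ys : Num.sqrt y ^+ 2 = y by rewrite sqr_sqrtr.
have -> : (y - 1) ^+ 2 = (Num.sqrt y + 1) ^+ 2 * (Num.sqrt y - 1) ^+ 2.
  by rewrite -{1}ys; ring.
apply: ler_pM (entropy_ge_sqrt y0); [exact: sqr_ge0|exact: sqr_ge0|].
move: (Num.sqrt y) s0 ys => s s0 ys.
have : 0 <= (s - 1) ^+ 2 by exact: sqr_ge0.
nra.
Qed.

(** The mass lost by truncation is controlled by the divergence, because
[entropy y >= y (ln y - 1)]. *)
Lemma le_truncate_entropy T y : 1 <= ln T -> 0 <= y ->
  (ln T - 1) * y <= (ln T - 1) * truncate T y + entropy y.
Proof.
move=> T1 y0; have e0 := entropy_ge0 y0.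
have T0 : 0 < T.
  by rewrite ltNge; apply/negP => /ln0 lnT; move: T1; rewrite lnT; lra.
rewrite /truncate; case: (leP y T) => yT; first lra.
have : ln T <= ln y by rewrite ler_ln ?posrE ?ltW// (lt_trans T0).
by rewrite /entropy; nra.
Qed.

Lemma ln_le_sqrt y : 0 < y -> 1 + ln y <= 2 * Num.sqrt y.
Proof.
move=> y0; have s0 : 0 < Num.sqrt y by rewrite sqrtr_gt0.
rewrite -{1}(sqr_sqrtr (ltW y0)) lnXn//.
have := @le_ln1Dx R (Num.sqrt y - 1) ltac:(lra).
by rewrite (_ : 1 + _ = Num.sqrt y); [lra|ring].
Qed.

End entropy.

(** * Densities of product laws *)

Section product_law.
Context d (T : measurableType d) (R : realType).
Local Open Scope ereal_scope.

(** The Radon-Nikodym property, stated on nonnegative integrands, which is the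
form in which it passes through iterated integrals. *)
Definition has_density d' (U : measurableType d') (P Q : probability U R)
    (L : U -> R) :=
  forall f : U -> \bar R, measurable_fun [set: U] f -> (forall x, 0 <= f x) ->
    \int[Q]_x f x = \int[P]_x ((L x)%:E * f x).

Let measurable_comp_cons n (F : n.+1.-tuple T -> \bar R) :
  measurable_fun [set: n.+1.-tuple T] F ->
  measurable_fun [set: T * n.-tuple T] (fun x => F (cons_pair x)).
Proof. by move=> mF; apply: (measurableT_comp mF); exact: measurable_cons. Qed.

Lemma integral_product_lawS n (P : 'I_n.+1 -> probability T R)
    (F : n.+1.-tuple T -> \bar R) :
  measurable_fun [set: n.+1.-tuple T] F -> (forall x, 0 <= F x) ->
  \int[product_law P]_x F x =
  \int[P ord0]_x \int[product_law (fun i => P (lift ord0 i))]_y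
    F (cons_pair (x, y)).
Proof.
move=> mF F0 /=; rewrite ge0_integral_distribution//.
rewrite fubini_tonelli1 => [||x]; [by []| |exact: F0].
exact: (measurable_comp_cons mF).
Qed.

(** Induction on the number of coordinates, integrating out the first one. *)
Lemma has_density_product_law n (P Q : 'I_n -> probability T R)
    (L : 'I_n -> T -> R) :
  (forall i, measurable_fun [set: T] (L i)) -> (forall i x, (0 <= L i x)%R) ->
  (forall i, has_density (P i) (Q i) (L i)) ->
  has_density (product_law P) (product_law Q)
    (fun x => \prod_(i < n) L i (tnth x i))%R.
Proof.
elim: n P Q L => [|n IH] P Q L mL L0 dL F mF F0.
  by apply: eq_integral => x _; rewrite big_ord0 mul1e.
pose G (x : n.+1.-tuple T) := (\prod_(i < n.+1) L i (tnth x i))%:E * F x.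
have mG : measurable_fun [set: n.+1.-tuple T] G.
  apply: emeasurable_funM => //; apply/measurable_EFinP.
  apply: measurable_prod => i _.
  by apply: measurableT_comp => //; exact: measurable_tnth.
have G0 x : 0 <= G x.
  by apply: mule_ge0 => //; rewrite lee_fin; exact: prodr_ge0.
have mFc : measurable_fun [set: T * n.-tuple T] (fun x => F (cons_pair x)).
  exact: (measurable_comp_cons mF).
have mFx x : measurable_fun [set: n.-tuple T] (fun y => F (cons_pair (x, y))).
  exact: (measurableT_comp mFc (pair1_measurable x)).
rewrite integral_product_lawS// (integral_product_lawS _ mG G0).
rewrite dL; last 2 first.
- exact: (@measurable_fun_fubini_tonelli_F _ _ _ _ _
    (product_law (fun i => Q (lift ord0 i))) _ mFc (fun=> F0 _)).
- by move=> x; exact: integral_ge0.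
apply: eq_integral => x _.
rewrite (IH (fun i => P (lift ord0 i)) _ (fun i => L (lift ord0 i)))//.
rewrite -ge0_integralZl//; last first.
- by rewrite lee_fin.
- by move=> y _; apply: mule_ge0 => //; rewrite lee_fin; exact: prodr_ge0.
- apply: emeasurable_funM => //; apply/measurable_EFinP.
  apply: measurable_prod => i _.
  by apply: measurableT_comp => //; exact: measurable_tnth.
apply: eq_integral => y _; rewrite /G big_ord_recl muleA -EFinM.
by under [in RHS]eq_bigr do rewrite tnthS.
Qed.

Lemma integral_product_law_tnth n (P : 'I_n -> probability T R) (i : 'I_n)
    (f : T -> \bar R) :
  measurable_fun [set: T] f -> (forall x, 0 <= f x) ->
  \int[product_law P]_x f (tnth x i) = \int[P i]_x f x.
Proof.
move=> mf f0; have mi := @measurable_tnth _ T n i.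
rewrite -(ge0_integral_pushforward mi _ measurableT mf)//.
apply: eq_measure_integral => A mA _.
pose B j := if j == i then A else [set: T]%classic.
have mB j : measurable (B j) by rewrite /B; case: ifP.
transitivity (product_law P [set x | forall j, B j (tnth x j)]%classic);
  last first.
  rewrite product_lawE// (bigD1 i)//= big1 ?mule1 /B ?eqxx// => j /negbTE->.
  exact: probability_setT.
congr (product_law P _); apply/seteqP; split => x /=; rewrite /B.
  by move=> Ax j; case: eqP => // ->.
by move=> /(_ i); rewrite eqxx.
Qed.

End product_law.

(** * Integrals of nonnegative real functions *)

(** All the integrands below are nonnegative, so their integrals can be added
and compared without integrability conditions. *)
Definition nnmfun {R : realType} d (U : measurableType d) (f : U -> R) :=
  measurable_fun [set: U] f /\ forall x, 0 <= f x.

Section nnmfun.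
Context {R : realType} d (U : measurableType d) (P : probability U R).
Implicit Types f g : U -> R.

Lemma nnmfun_cst (k : R) : 0 <= k -> nnmfun (fun _ : U => k).
Proof. by move=> k0; split. Qed.

Lemma nnmfunD f g : nnmfun f -> nnmfun g -> nnmfun (fun x => f x + g x).
Proof.
by move=> [mf f0] [mg g0]; split=> [|x]; [exact: measurable_funD|exact: addr_ge0].
Qed.

Lemma nnmfunM f g : nnmfun f -> nnmfun g -> nnmfun (fun x => f x * g x).
Proof.
by move=> [mf f0] [mg g0]; split=> [|x]; [exact: measurable_funM|exact: mulr_ge0].
Qed.

Lemma nnmfunZ (k : R) f : 0 <= k -> nnmfun f -> nnmfun (fun x => k * f x).
Proof. by move=> k0 hf; apply: nnmfunM => //; exact: nnmfun_cst. Qed.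

Lemma nnmfun_sum I (s : seq I) (A : pred I) (f : I -> U -> R) :
  (forall i, A i -> nnmfun (f i)) -> nnmfun (fun x => \sum_(i <- s | A i) f i x).
Proof.
move=> hf; elim: s => [|i s IH].
  rewrite (_ : (fun x => _) = fun=> 0); first exact: nnmfun_cst.
  by apply/funext => x; rewrite big_nil.
rewrite (_ : (fun x => _) = fun x => (if A i then f i x else 0) +
    \sum_(j <- s | A j) f j x).
  apply: nnmfunD => //.
  by case: (A i) (hf i) => [|_]; [exact|exact: nnmfun_cst].
by apply/funext => x; rewrite big_cons; case: ifP => //; rewrite add0r.
Qed.

Lemma nnmfun_indic (A : set U) : measurable A -> nnmfun (\1_A : U -> R).
Proof. by move=> mA; split=> // x; rewrite indicE. Qed.

Local Open Scope ereal_scope.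

Lemma nnintegral_cst (k : R) : \int[P]_x k%:E = k%:E.
Proof.
have -> := integral_cst P (@measurableT _ U) k%:E.
by rewrite /= probability_setT mule1.
Qed.

Lemma nnintegralD f g : nnmfun f -> nnmfun g ->
  \int[P]_x (f x + g x)%:E = \int[P]_x (f x)%:E + \int[P]_x (g x)%:E.
Proof.
move=> [mf f0] [mg g0]; under eq_integral do rewrite EFinD.
by rewrite ge0_integralD//; do ?exact/measurable_EFinP;
  move=> x _; rewrite lee_fin.
Qed.

Lemma nnintegralZ (k : R) f : (0 <= k)%R -> nnmfun f ->
  \int[P]_x (k * f x)%:E = k%:E * \int[P]_x (f x)%:E.
Proof.
move=> k0 [mf f0]; under eq_integral do rewrite EFinM.
by rewrite ge0_integralZl_EFin//; [move=> x _; rewrite lee_fin|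
  exact/measurable_EFinP].
Qed.

Lemma nnintegral_sum I (s : seq I) (A : pred I) (f : I -> U -> R) :
  (forall i, A i -> nnmfun (f i)) ->
  \int[P]_x (\sum_(i <- s | A i) f i x)%:E =
  \sum_(i <- s | A i) \int[P]_x (f i x)%:E.
Proof.
move=> hf; elim: s => [|i s IH].
  by under eq_integral do rewrite big_nil; rewrite big_nil nnintegral_cst.
rewrite big_cons; under eq_integral do rewrite big_cons.
case: (A i) (hf i) => [/(_ isT) hfi|_]; last exact: IH.
by rewrite nnintegralD ?IH//; exact: nnmfun_sum.
Qed.

Lemma le_nnintegral f g : nnmfun f -> nnmfun g -> (forall x, f x <= g x)%R ->
  \int[P]_x (f x)%:E <= \int[P]_x (g x)%:E.
Proof.
move=> [mf f0] [mg g0] fg; apply: ge0_le_integral => //;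
  do ?exact/measurable_EFinP; by move=> x _; rewrite lee_fin.
Qed.

Lemma nnintegral_ge0 f : nnmfun f -> 0 <= \int[P]_x (f x)%:E.
Proof. by move=> [_ f0]; apply: integral_ge0 => x _; rewrite lee_fin. Qed.

Lemma nnintegral_indic (A : set U) : measurable A ->
  \int[P]_x (\1_A x)%:E = P A.
Proof. by move=> mA; rewrite integral_indic// setIT. Qed.

End nnmfun.

(** * Undetectable sparse mixtures *)

Section sparse_mixture.
Context d (T : measurableType d) (R : realType) (n : nat).
Context (P Q : 'I_n -> probability T R) (L : 'I_n -> T -> R).
Context (hL : forall i, nnmfun (L i)).
Context (dL : forall i, has_density (P i) (Q i) (L i)).

Definition replace_laws (S : {set 'I_n}) j := if j \in S then Q j else P j.

Local Notation PP := (product_law P).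

Lemma has_density_replace_laws (S : {set 'I_n}) :
  has_density PP (product_law (replace_laws S))
    (fun x => \prod_(i in S) L i (tnth x i)).
Proof.
move=> F mF F0.
pose M i := if i \in S then L i else fun=> 1.
have mM i : measurable_fun [set: T] (M i).
  by rewrite /M; case: ifP => // _; exact: (hL i).1.
have M0 i x : 0 <= M i x by rewrite /M; case: ifP => // _; exact: (hL i).2.
rewrite (has_density_product_law (P := P) mM M0)//; last first.
  move=> i; rewrite /replace_laws /M; case: ifP => // _ f mf f0.
  by apply: eq_integral => x _; rewrite mul1e.
apply: eq_integral => x _; congr (_%:E * _)%E; rewrite [RHS]big_mkcond/=.
by apply: eq_bigr => i _; rewrite /M; case: ifP.
Qed.

Lemma nnmfun_tnth (f : T -> R) i :
  nnmfun f -> nnmfun (fun x : n.-tuple T => f (tnth x i)).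
Proof.
move=> [mf f0]; split=> // ; apply: measurableT_comp => //.
exact: measurable_tnth.
Qed.

Let Li i (x : n.-tuple T) := L i (tnth x i).

Let hLi i : nnmfun (Li i). Proof. exact: nnmfun_tnth. Qed.

Lemma measure_replace_law1 i (A : set (n.-tuple T)) : measurable A ->
  product_law (replace_laws [set i]) A = (\int[PP]_x (Li i x * \1_A x)%:E)%E.
Proof.
move=> mA; have [m1 i0] := nnmfun_indic (R := R) mA.
rewrite -nnintegral_indic// has_density_replace_laws//; last first.
  exact/measurable_EFinP.
by apply: eq_integral => x _; rewrite big_set1.
Qed.

Lemma integral_density1 i : (\int[PP]_x (Li i x)%:E = 1)%E.
Proof.
rewrite -[RHS](@probability_setT _ _ _ (product_law (replace_laws [set i]))).
rewrite measure_replace_law1//; apply: eq_integral => x _.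
by rewrite indicT mulr1.
Qed.

(** Both sides are the total mass of the law in which the coordinates [i] and
[j] are replaced. *)
Lemma integral_density2 i j : i != j -> (\int[PP]_x (Li i x * Li j x)%:E = 1)%E.
Proof.
move=> ij; pose Qij := product_law (replace_laws [set i; j]).
rewrite -[RHS](nnintegral_cst Qij 1).
rewrite has_density_replace_laws//; apply: eq_integral => x _.
by rewrite mule1 big_setU1 ?inE//= big_set1.
Qed.

Let V t i (x : n.-tuple T) := truncate t (Li i x).

Let hV t i : nnmfun (V t i).
Proof.
split=> [|x]; last by apply: truncate_ge0; exact: (hLi i).2.
rewrite /V /truncate; apply: measurable_fun_ifT => //.
- by apply: measurable_fun_ler => //; exact: (hLi i).1.
- exact: (hLi i).1.
Qed.

Let nnmfun_entropy i : nnmfun (fun x => entropy (L i x)).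
Proof.
split=> [|x]; last by apply: entropy_ge0; exact: (hL i).2.
apply: measurable_funD => //; apply: measurable_funB; last exact: (hL i).1.
apply: measurable_funM; first exact: (hL i).1.
by apply: measurableT_comp; [exact: measurable_ln|exact: (hL i).1].
Qed.

Let integral_entropy i :
  (\int[PP]_x (entropy (Li i x))%:E = \int[P i]_x (entropy (L i x))%:E)%E.
Proof.
rewrite -(integral_product_law_tnth P i)//.
- by apply/measurable_EFinP; exact: (nnmfun_entropy i).1.
- by move=> x; rewrite lee_fin; exact: (nnmfun_entropy i).2.
Qed.

(** The integral of [le_truncate_entropy], divided by [ln t - 1]. *)
Lemma truncated_mean_ge t D i : 1 < ln t ->
  (\int[P i]_x (entropy (L i x))%:E <= D%:E)%E ->
  ((1 - D / (ln t - 1))%:E <= \int[PP]_x (V t i x)%:E)%E.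
Proof.
move=> t1; rewrite -integral_entropy => kl.
have t0 : 0 < ln t - 1 by rewrite subr_gt0.
have hE := nnmfun_tnth i (nnmfun_entropy i).
have V1 : (\int[PP]_x (V t i x)%:E <= 1)%E.
  rewrite -(integral_density1 i); apply: le_nnintegral => // x.
  by apply: truncate_le; exact: (hLi i).2.
have : (\int[PP]_x ((ln t - 1) * Li i x)%:E <=
        \int[PP]_x ((ln t - 1) * V t i x + entropy (Li i x))%:E)%E.
  apply: le_nnintegral => [||x].
  - by apply: nnmfunZ => //; exact: ltW.
  - by apply: nnmfunD => //; apply: nnmfunZ => //; exact: ltW.
  - by apply: le_truncate_entropy; [exact: ltW|exact: (hLi i).2].
rewrite nnintegralD//; last by apply: nnmfunZ => //; exact: ltW.
rewrite !nnintegralZ//; try exact: ltW.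
rewrite integral_density1 mule1.
move: V1 (nnintegral_ge0 PP (hV t i)) kl.
case: (integral PP _ _) => [r| |]//.
move=> _ _ kl H; have := le_trans H (leeD2l _ kl).
rewrite -EFinM -EFinD !lee_fin => {}H.
by rewrite lerBlDr -(ler_pM2l t0) mulr1 mulrDr (mulrC _ (D / _)) divfK ?gt_eqF.
Qed.

(** The integral of [truncate_sqr_le], whose linear term has mean 2. *)
Lemma truncated_sqr_le t D i : 1 <= t ->
  (\int[P i]_x (entropy (L i x))%:E <= D%:E)%E ->
  (\int[PP]_x (V t i x * V t i x)%:E <= (1 + 4 * t * D)%:E)%E.
Proof.
move=> t1; rewrite -integral_entropy => kl.
have t0 : 0 <= 4 * t by lra.
have hE := nnmfun_tnth i (nnmfun_entropy i).
have : (\int[PP]_x (V t i x * V t i x + 1)%:E <=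
        \int[PP]_x (2 * Li i x + 4 * t * entropy (Li i x))%:E)%E.
  apply: le_nnintegral => [||x].
  - by apply: nnmfunD; [exact: nnmfunM|exact: nnmfun_cst].
  - by apply: nnmfunD; exact: nnmfunZ.
  - by apply: truncate_sqr_le => //; exact: (hLi i).2.
rewrite !nnintegralD//; try exact: nnmfunM; try exact: nnmfunZ;
  try exact: nnmfun_cst.
rewrite !nnintegralZ// integral_density1 mule1 nnintegral_cst => H.
have : (\int[PP]_x (V t i x * V t i x)%:E + 1 <= 2 + (4 * t)%:E * D%:E)%E.
  apply: le_trans H _; apply: leeD2l.
  by apply: lee_wpmul2l => //; rewrite lee_fin.
rewrite -EFinM -EFinD -leeBrDr// -EFinB => /le_trans; apply.
by rewrite lee_fin; lra.
Qed.

(** A lower bound of the likelihood ratio of the uniform mixture over [J], with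
the truncation done in each coordinate separately so that the product structure
still gives its moments. *)
Let W (J : {set 'I_n}) t x := #|J|%:R^-1 * \sum_(i in J) V t i x.

Let hW J t : nnmfun (W J t).
Proof. by apply: nnmfunZ => //; exact: nnmfun_sum. Qed.

Lemma mean_average_ge (J : {set 'I_n}) t m : (0 < #|J|)%N ->
  (forall i, i \in J -> (m%:E <= \int[PP]_x (V t i x)%:E)%E) ->
  (m%:E <= \int[PP]_x (W J t x)%:E)%E.
Proof.
move=> J0 hm; rewrite nnintegralZ//; last exact: nnmfun_sum.
rewrite nnintegral_sum//.
have : (\sum_(i in J) m%:E <= \sum_(i in J) \int[PP]_x (V t i x)%:E)%E.
  exact: lee_sum.
rewrite sumEFin sumr_const => /(lee_wpmul2l (x := (#|J|%:R^-1)%:E)).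
rewrite lee_fin invr_ge0 ler0n => /(_ isT); apply: le_trans.
by rewrite -EFinM lee_fin -[m *+ _]mulr_natl mulKf// pnatr_eq0 -lt0n.
Qed.

Lemma second_moment_average_le (J : {set 'I_n}) t B : (0 < #|J|)%N ->
  (forall i, i \in J -> (\int[PP]_x (V t i x * V t i x)%:E <= (1 + B)%:E)%E) ->
  (\int[PP]_x (W J t x * W J t x)%:E <= (1 + B / #|J|%:R)%:E)%E.
Proof.
move=> J0 hB; set K : R := #|J|%:R; have K0 : 0 < K by rewrite ltr0n.
have hVV i j : nnmfun (fun x => V t i x * V t j x) by exact: nnmfunM.
have hsum i : nnmfun (fun x => \sum_(j in J) V t i x * V t j x).
  exact: nnmfun_sum.
have -> : (\int[PP]_x (W J t x * W J t x)%:E =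
   \int[PP]_x ((K ^- 2) * \sum_(i in J) \sum_(j in J) V t i x * V t j x)%:E)%E.
  apply: eq_integral => x _; congr EFin; rewrite /W -/K.
  rewrite mulrACA -exprVn expr2 mulr_suml; congr (_ * _).
  by apply: eq_bigr => i _; rewrite mulr_sumr.
have K20 : 0 <= K ^- 2 by rewrite invr_ge0 exprn_ge0// ltW.
rewrite nnintegralZ//; last exact: nnmfun_sum.
rewrite nnintegral_sum//.
have H i : i \in J ->
    (\int[PP]_x (\sum_(j in J) V t i x * V t j x)%:E <= (K + B)%:E)%E.
  move=> iJ; rewrite nnintegral_sum//.
  have -> : K + B = \sum_(j in J) (1 + if j == i then B else 0).
    rewrite big_split/= sumr_const -mulr_natl mulr1 -big_mkcondr/=.
    by congr (_ + _); rewrite (big_pred1 i)// => j; rewrite andb_idl// => /eqP->.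
  rewrite -sumEFin; apply: lee_sum => j jJ.
  (* off the diagonal, truncation only decreases a moment equal to 1 *)
  have [->|ji] := eqVneq j i; first exact: hB.
  rewrite addr0 -(integral_density2 (i := i) (j := j)) 1?eq_sym//.
  apply: le_nnintegral => // [|x]; first exact: nnmfunM.
  by apply: ler_pM; rewrite ?(hV t _).2// truncate_le// (hLi _).2.
have : (\sum_(i in J) \int[PP]_x (\sum_(j in J) V t i x * V t j x)%:E <=
        \sum_(i in J) (K + B)%:E)%E by exact: lee_sum.
rewrite sumEFin sumr_const => /(lee_wpmul2l (x := (K ^- 2)%:E)).
rewrite lee_fin => /(_ K20) /le_trans; apply.
rewrite -EFinM lee_fin -[(K + B) *+ _]mulr_natl -/K.
rewrite le_eqVlt; apply/orP; left; apply/eqP.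
by field; rewrite gt_eqF.
Qed.

(** Without truncation, [W] would be the likelihood ratio of the uniform mixture
over [J], which gives [A] the average of the masses given by its components. *)
Lemma restricted_average_le (J : {set 'I_n}) t (A : set (n.-tuple T)) (b : R) :
  (0 < #|J|)%N -> measurable A ->
  (forall i, i \in J -> (product_law (replace_laws [set i]) A <= b%:E)%E) ->
  (\int[PP]_x (\1_A x * W J t x)%:E <= b%:E)%E.
Proof.
move=> J0 mA hb; set K : R := #|J|%:R; have K0 : 0 < K by rewrite ltr0n.
have hA := nnmfun_indic (R := R) mA.
have hLA i : nnmfun (fun x => Li i x * \1_A x) by exact: nnmfunM.
have hsum : nnmfun (fun x => \sum_(i in J) Li i x * \1_A x).
  exact: nnmfun_sum.
have Ki0 : 0 <= K^-1 by rewrite invr_ge0 ltW.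
have le1 : (\int[PP]_x (\1_A x * W J t x)%:E <=
    \int[PP]_x (K^-1 * \sum_(i in J) Li i x * \1_A x)%:E)%E.
  apply: le_nnintegral => [||x]; [exact: nnmfunM|exact: nnmfunZ|].
  rewrite /W mulrCA ler_wpM2l// mulr_sumr; apply: ler_sum => i _.
  by rewrite mulrC ler_wpM2r ?hA.2// truncate_le// (hLi i).2.
apply: le_trans le1 _; rewrite nnintegralZ// nnintegral_sum//.
have : (\sum_(i in J) \int[PP]_x (Li i x * \1_A x)%:E <=
        \sum_(i in J) b%:E)%E.
  by apply: lee_sum => i iJ; rewrite -measure_replace_law1//; exact: hb.
move=> /(lee_wpmul2l (x := (K^-1)%:E)); rewrite lee_fin => /(_ Ki0) /le_trans.
apply; rewrite sumEFin sumr_const -EFinM lee_fin -[b *+ _]mulr_natl -/K mulKf//.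
by rewrite gt_eqF.
Qed.

(** The bound [b] stands for the worst type II error.  With [e] the indicator of
the rejection region, [e + (1 - e) W >= 1 - |W - 1|], and
[2 |W - 1| <= a + (W - 1)^2 / a]. The latter is used in the form
[1 + W / a <= e + (1 - e) W + a / 2 + (W^2 + 1) / (2 a)], both sides of which
are nonnegative. *)
Theorem sparse_mixture_bound (J : {set 'I_n}) (c a : R)
    (E : set (n.-tuple T)) (b : \bar R) :
  (0 < #|J|)%N -> 0 < a -> 0 <= c -> (8 * expR 2 + 4) * c <= a ^+ 2 ->
  (forall i, i \in J ->
    (\int[P i]_x (entropy (L i x))%:E <= (c * (1 + ln #|J|%:R))%:E)%E) ->
  measurable E ->
  (forall i, i \in J ->
    (product_law (replace_laws [set i]) (~` E)%classic <= b)%E) ->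
  ((1 - a)%:E <= PP E + b)%E.
Proof.
move=> J0 a0 c0 ca kl mE hb; set K : R := #|J|%:R.
have K0 : 0 < K by rewrite ltr0n.
have K1 : 1 <= K by rewrite ler1n.
have [i0 i0J] : exists i, i \in J by apply/set0Pn; rewrite -cards_eq0 -lt0n.
(* an infinite b is either trivial or excluded by the positivity of measures *)
case: b hb => [b hb|_|hb]; last 2 first.
- by rewrite addey ?leey// gt_eqF// (lt_le_trans ltNy0).
- by have := hb _ i0J; rewrite leNgt (lt_le_trans ltNy0).
(* ln t = 2 + (ln K) / 2 makes ln t - 1 at least half of 1 + ln K, while t / K
   times 1 + ln K stays bounded *)
set s : R := Num.sqrt K; set t : R := expR 2 * s.
have s1 : 1 <= s by rewrite -sqrtr1 ler_sqrt// ltW.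
have s0 : 0 < s by lra.
have Ks : K = s ^+ 2 by rewrite sqr_sqrtr// ltW.
have e2 : 3 <= expR 2 :> R by have := expR_ge1Dx (2 : R); lra.
have t1 : 1 <= t by rewrite /t; nra.
have lnK : ln K = 2 * ln s by rewrite Ks lnXn// mulr_natl.
have lns0 : 0 <= ln s by exact: ln_ge0.
have lnt : ln t = 2 + ln s by rewrite lnM ?posrE ?expR_gt0// expRK.
have mean : ((1 - 2 * c)%:E <= \int[PP]_x (W J t x)%:E)%E.
  apply: mean_average_ge => // i iJ.
  have := truncated_mean_ge (t := t) _ (kl i iJ); rewrite lnt.
  move=> /(_ ltac:(lra)); apply: le_trans; rewrite lee_fin -/K lnK.
  rewrite lerD2l lerN2 ler_pdivrMr; last lra.
  by nra.
have second : (\int[PP]_x (W J t x * W J t x)%:E <= (1 + 8 * expR 2 * c)%:E)%E.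
  have := second_moment_average_le J0 (fun i iJ => truncated_sqr_le t1 (kl i iJ)).
  move=> /le_trans; apply; rewrite lee_fin -/K.
  rewrite lerD2l ler_pdivrMr// [X in _ <= _ * X]Ks /t.
  have H := ler_wpM2l (_ : 0 <= 4 * expR 2 * s * c) (ln_le_sqrt K0).
  have := H ltac:(by rewrite !mulr_ge0 ?expR_ge0// ltW).
  rewrite -/s; lra.
have avg := restricted_average_le t J0 (measurableC mE) hb.
have hE := nnmfun_indic (R := R) mE.
have hEc := nnmfun_indic (R := R) (measurableC mE).
have ai0 : 0 <= a^-1 by rewrite invr_ge0 ltW.
have a2i0 : 0 <= (2 * a)^-1 by rewrite invr_ge0 mulr_ge0// ltW.
have hWW : nnmfun (fun x => W J t x * W J t x) by exact: nnmfunM.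
have hWE : nnmfun (fun x => \1_(~` E)%classic x * W J t x) by exact: nnmfunM.
have h1 : nnmfun (fun _ : n.-tuple T => 1 : R) by exact: nnmfun_cst.
have ha : nnmfun (fun _ : n.-tuple T => a / 2) by apply: nnmfun_cst; lra.
have hWW1 := nnmfunD hWW h1.
have ptw x : 1 + a^-1 * W J t x <= \1_E x + \1_(~` E)%classic x * W J t x +
     (a / 2 + (2 * a)^-1 * (W J t x * W J t x + 1)).
  have u0 : 0 <= a^-1 / 2 by lra.
  rewrite !indicE in_setC invfM; case: (x \in E) => /=.
  - have := mulr_ge0 u0 (addr_ge0 (sqr_ge0 (W J t x - 1)) (sqr_ge0 a)).
    suff -> : a^-1 / 2 * ((W J t x - 1) ^+ 2 + a ^+ 2) =
       a^-1 / 2 * (W J t x - 1) ^+ 2 + a / 2 by lra.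
    by field; lra.
  - have := mulr_ge0 u0 (sqr_ge0 (W J t x - 1 + a)).
    suff -> : a^-1 / 2 * (W J t x - 1 + a) ^+ 2 =
       a^-1 / 2 * (W J t x - 1) ^+ 2 + (W J t x - 1) + a / 2 by lra.
    by field; lra.
have : (\int[PP]_x (1 + a^-1 * W J t x)%:E <=
    \int[PP]_x (\1_E x + \1_(~` E)%classic x * W J t x +
     (a / 2 + (2 * a)^-1 * (W J t x * W J t x + 1)))%:E)%E.
  apply: le_nnintegral => //; first by apply: nnmfunD => //; exact: nnmfunZ.
  by apply: nnmfunD; apply: nnmfunD => //; exact: nnmfunZ.
rewrite !nnintegralD//; try exact: nnmfunZ; try exact: nnmfunD;
  last by apply: nnmfunD => //; exact: nnmfunZ.
rewrite (nnintegralZ PP ai0 (hW J t)) (nnintegralZ PP a2i0 hWW1).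
rewrite nnintegralD// !nnintegral_cst nnintegral_indic//.
move=> H.
have low : ((1 + a^-1 * (1 - 2 * c))%:E <=
    1 + (a^-1)%:E * \int[PP]_x (W J t x)%:E)%E.
  by rewrite EFinD EFinM; apply: leeD2l; apply: lee_wpmul2l; rewrite ?lee_fin.
have up : (\int[PP]_x (\1_(~` E)%classic x * W J t x)%:E +
   ((a / 2)%:E + ((2 * a)^-1)%:E * (\int[PP]_x (W J t x * W J t x)%:E + 1)) <=
   (b + (a / 2 + (2 * a)^-1 * (1 + 8 * expR 2 * c + 1)))%:E)%E.
  rewrite EFinD; apply: leeD => //; rewrite EFinD; apply: leeD2l.
  rewrite EFinM; apply: lee_wpmul2l; first by rewrite lee_fin.
  by rewrite EFinD; exact: leeD2r.
have := le_trans low (le_trans H _).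
rewrite -addeA => /(_ _ (leeD2l _ up)).
rewrite -(@fineK _ (PP E)) ?fin_num_measure// -!EFinD !lee_fin invfM.
move: (fine _) => p {}H.
have au : a^-1 * a ^+ 2 = a by field; lra.
have := ler_wpM2l ai0 ca; rewrite au; lra.
Qed.

End sparse_mixture.

(** * Poisson laws *)

Section poisson.
Context {R : realType}.
Implicit Types (r mu eps : R) (k : nat).

Local Notation poisson r := (poisson_prob r 0 : probability nat R).

Lemma poisson_pmfE r k : 0 < r -> poisson_pmf r k = r ^+ k / k`!%:R * expR (- r).
Proof. by move=> r0; rewrite /poisson_pmf r0. Qed.

Lemma integral_poisson r (f : nat -> \bar R) : 0 < r -> (forall k, 0 <= f k)%E ->
  (\int[poisson r]_k f k = \sum_(0 <= k <oo) (poisson_pmf r k)%:E * f k)%E.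
Proof.
move=> r0 f0; pose m k := mscale (NngNum (poisson_pmf_ge0 r k)) \d_k.
rewrite (eq_measure_integral (mseries m 0)); last first.
  move=> A _ _; rewrite /= /poisson_prob r0 esum_mkcond -nneseries_esumT;
      last first.
    by move=> k; case: ifP => // _; rewrite lee_fin poisson_pmf_ge0.
  apply: eq_eseriesr => k _.
  transitivity ((poisson_pmf r k)%:E * \d_k A)%E => //.
  by rewrite diracE; case: (k \in A); rewrite ?mule1 ?mule0.
rewrite ge0_integral_measure_series//; apply: eq_eseriesr => k _.
by rewrite ge0_integral_mscale// integral_dirac// diracT mul1e.
Qed.

(** The likelihood ratio of the rate [mu + eps] to the rate [mu]. *)
Definition poisson_lr mu eps k : R := (1 + eps / mu) ^+ k * expR (- eps).

Lemma poisson_lr_gt0 mu eps k : 0 < mu -> 0 <= eps -> 0 < poisson_lr mu eps k.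
Proof.
move=> mu0 e0; rewrite mulr_gt0 ?expR_gt0// exprn_gt0//.
by rewrite ltr_wpDr// divr_ge0// ltW.
Qed.

Lemma nnmfun_nat (f : nat -> R) : (forall k, 0 <= f k) -> nnmfun f.
Proof. by move=> f0; split. Qed.

Lemma has_density_poisson mu eps : 0 < mu -> 0 <= eps ->
  has_density (poisson mu) (poisson (mu + eps)) (poisson_lr mu eps).
Proof.
move=> mu0 e0 f _ f0; have lr0 k := ltW (poisson_lr_gt0 k mu0 e0).
have me0 : 0 < mu + eps by rewrite ltr_wpDr.
have Lf0 k : (0 <= (poisson_lr mu eps k)%:E * f k)%E.
  by rewrite mule_ge0// lee_fin.
rewrite (integral_poisson me0 f0) (integral_poisson mu0 Lf0).
apply: eq_eseriesr => k _; rewrite muleA -EFinM; congr (_%:E * _)%E.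
rewrite !poisson_pmfE// /poisson_lr opprD expRD.
have -> : mu + eps = mu * (1 + eps / mu) by field; rewrite gt_eqF.
by rewrite exprMn; ring.
Qed.

(** Shifting the index turns [k r^k / k!] into [r] times the total mass. *)
Lemma poisson_mean r : 0 < r -> (\int[poisson r]_k (k%:R)%:E = r%:E)%E.
Proof.
move=> r0; rewrite integral_poisson//.
have p0 k : (0 <= (poisson_pmf r k)%:E * k%:R%:E)%E.
  by rewrite -EFinM lee_fin mulr_ge0// poisson_pmf_ge0.
rewrite nneseries_recl// mule0 add0e -nneseries_addn//.
transitivity (r%:E * \sum_(0 <= k <oo) (poisson_pmf r k)%:E * 1)%E; last first.
  by rewrite -(integral_poisson (f := fun=> 1%E))// nnintegral_cst mule1.
rewrite -nneseriesZl//; last by move=> k _; rewrite mule1 lee_fin poisson_pmf_ge0.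
apply: eq_eseriesr => k _; rewrite mule1 -!EFinM addn1; congr EFin.
rewrite !poisson_pmfE// factS natrM exprS; field.
by rewrite nat1r !pnatr_eq0 -lt0n fact_gt0.
Qed.

(** With [L] the likelihood ratio, [ln L] is affine in [k], so only the total
mass and the mean of the Poisson law of rate [mu + eps] are involved. *)
Lemma poisson_kl mu eps : 0 < mu -> 0 <= eps ->
  (\int[poisson mu]_k (entropy (poisson_lr mu eps k))%:E =
   (mu * h (eps / mu))%:E)%E.
Proof.
move=> mu0 e0; set L := poisson_lr mu eps.
have L0 k : 0 <= L k by exact/ltW/poisson_lr_gt0.
have r0 : 0 <= eps / mu by rewrite divr_ge0// ltW.
have r1 : 0 < 1 + eps / mu by rewrite ltr_wpDr.
have l0 : 0 <= ln (1 + eps / mu) by rewrite ln_ge0// lerDl.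
have e1 : 0 <= 1 + eps by rewrite addr_ge0.
have hL : nnmfun L by exact: nnmfun_nat.
have hEnt : nnmfun (fun k => entropy (L k)).
  by apply: nnmfun_nat => k; exact: entropy_ge0.
have hk : nnmfun (fun k => L k * k%:R : R).
  by apply: nnmfun_nat => k; rewrite mulr_ge0.
have h1 : nnmfun (fun _ : nat => 1 : R) by exact: nnmfun_cst.
have dL := has_density_poisson mu0 e0.
(* an identity between nonnegative integrands: the negative terms of the entropy
   are moved to the left-hand side *)
have : (\int[poisson mu]_k (entropy (L k) + (1 + eps) * L k)%:E =
        \int[poisson mu]_k (ln (1 + eps / mu) * (L k * k%:R) + 1)%:E)%E.
  apply: eq_integral => k _; congr EFin.
  have lnL : ln (L k) = k%:R * ln (1 + eps / mu) - eps.
    by rewrite lnM ?posrE ?expR_gt0 ?exprn_gt0// expRK lnXn// mulr_natl.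
  by rewrite /entropy lnL; ring.
rewrite (nnintegralD _ hEnt (nnmfunZ e1 hL)) (nnintegralD _ (nnmfunZ l0 hk) h1).
rewrite (nnintegralZ _ e1 hL) (nnintegralZ _ l0 hk) nnintegral_cst.
have -> : (\int[poisson mu]_k (L k)%:E = 1)%E.
  rewrite -[RHS](nnintegral_cst (poisson (mu + eps)) 1) dL//.
  by apply: eq_integral => k _; rewrite mule1.
have -> : (\int[poisson mu]_k (L k * k%:R)%:E = (mu + eps)%:E)%E.
  by rewrite -poisson_mean ?ltr_wpDr// dL.
rewrite mule1; case: (integral _ _ _) => [x| |]//= [] H; congr EFin.
rewrite hE// (_ : mu * _ = (mu + eps) * ln (1 + eps / mu) - eps); first lra.
by move: (ln _) => l; field; rewrite gt_eqF.
Qed.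

End poisson.

(** * The minimax lower bound *)

Section main.
Context {R : realType}.

Definition raise_rate p (mu : 'rV[R]_p) (i : 'I_p) (eps : R) : 'rV[R]_p :=
  \row_j (if j == i then mu ord0 j + eps else mu ord0 j).

Lemma raise_rate_alternative p (mu : 'rV[R]_p) i eps :
  (forall j, 0 < mu ord0 j) -> 0 <= eps ->
  alternative mu eps (raise_rate mu i eps).
Proof.
move=> mu0 e0; split=> [j|].
  by rewrite mxE; case: eqP => _; rewrite ?addr_ge0// ltW.
rewrite /Num.norm/= mx_normrE.
apply: le_trans (le_bigmax _ _ (ord0, i)) => /=.
by rewrite !mxE eqxx opprD addNKr normrN ger0_norm.
Qed.

Lemma poisson_law_raise_rate p (mu : 'rV[R]_p) i eps :
  poisson_law (raise_rate mu i eps) =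
  product_law (replace_laws
     (fun j => poisson_prob (mu ord0 j) 0 : probability nat R)
     (fun j => poisson_prob (mu ord0 j + eps) 0 : probability nat R) [set i]).
Proof.
congr product_law; apply/funext => j; rewrite /replace_laws inE mxE.
by case: eqP.
Qed.

(** The divergence caused by the radius [c muk h_inv (z / muk)] at a rate [mu]
above [muk]: the argument of [h] is [t h_inv (z / muk)] with
[t = c muk / mu <= 1], and [h_mul_le] applies. *)
Lemma perspective_h_le (c mu muk z : R) :
  0 <= c <= 1 -> 0 < muk -> muk <= mu -> 0 <= z ->
  mu * h (c * (muk * h_inv (z / muk)) / mu) <= c * z.
Proof.
move=> /andP[c0 c1] muk0 muk_le z0; have mu0 := lt_le_trans muk0 muk_le.
have [y0 hy] : 0 <= h_inv (z / muk) /\ h (h_inv (z / muk)) = z / muk.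
  by apply: h_invP; rewrite divr_ge0// ltW.
rewrite (_ : _ / mu = c * (muk / mu) * h_inv (z / muk)); last first.
  by field; rewrite gt_eqF.
have t01 : 0 <= c * (muk / mu) <= 1.
  have q0 : 0 <= muk / mu by rewrite divr_ge0// ltW.
  have q1 : muk / mu <= 1 by rewrite ler_pdivrMr// mul1r.
  by rewrite mulr_ge0//= mulr_ile1.
apply: le_trans (ler_wpM2l (ltW mu0) (h_mul_le t01 y0)) _.
by rewrite hy le_eqVlt; apply/orP; left; apply/eqP; field; rewrite !gt_eqF.
Qed.

(** The mixture runs over the [k.+1] largest rates, where [k] attains the maximum
in the critical radius: the monotonicity of [mu] bounds all their divergences
by the one at [k]. *)
Lemma minimax_risk_ge p (mu : 'rV[R]_p) (c eta : R) : (1 <= p)%N ->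
  (forall i j : 'I_p, (i <= j)%N -> mu ord0 j <= mu ord0 i) ->
  (forall j : 'I_p, 0 < mu ord0 j) ->
  0 < c <= 1 -> 0 < 1 - eta -> (8 * expR 2 + 4) * c <= (1 - eta) ^+ 2 ->
  (eta%:E <= minimax_risk (c * critical_radius mu) mu)%E.
Proof.
move=> p0 mu_mono mu0 /andP[c0 c1] eta1 ceta.
pose z (j : 'I_p) : R := ln (expR 1 * j.+1%:R).
have zE j : z j = 1 + ln j.+1%:R by rewrite /z lnM ?posrE ?expR_gt0// expRK.
have z0 j : 0 <= z j by rewrite zE addr_ge0// ln_ge0// ler1n.
have y0 j : 0 <= h_inv (z j / mu ord0 j).
  by apply: (h_invP _).1; rewrite divr_ge0// ltW.
have [k _ kE] := @eq_bigmax _ R _ 0 (Ordinal p0) xpredT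
  (fun j => mu ord0 j * h_inv (z j / mu ord0 j)) isT
  (fun j _ => mulr_ge0 (ltW (mu0 j)) (y0 j)).
rewrite /critical_radius -/z kE; set eps := c * _.
have e0 : 0 <= eps by rewrite !mulr_ge0// ltW.
pose J : {set 'I_p} := [set widen_ord (ltn_ord k) i | i : 'I_k.+1].
have cardJ : #|J| = k.+1.
  rewrite card_imset ?card_ord// => i j /(congr1 val) /= ij.
  exact: val_inj.
apply: le_ereal_inf_tmp => _ [phi _ <-].
pose E : set (p.-tuple nat) := [set x | phi x = true]%classic.
have mE : measurable E.
  rewrite (_ : E = phi @^-1` [set true])%classic //.
  by rewrite -[X in measurable X]setTI; exact: (measurable_funPT phi).
have EcE : (~` E = [set x | phi x = false])%classic.
  by apply/seteqP; split=> x; rewrite /E /=; case: (phi x).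
have etaE : eta = 1 - (1 - eta) by ring.
have hL i : nnmfun (poisson_lr (mu ord0 i) eps).
  by apply: nnmfun_nat => x; exact/ltW/poisson_lr_gt0.
have dL i := has_density_poisson (mu0 i) e0.
rewrite {1}etaE; apply: (sparse_mixture_bound hL dL (J := J) (c := c)) => //.
- by rewrite cardJ.
- exact: ltW.
- move=> i /imsetP[j _ ij]; rewrite poisson_kl// lee_fin cardJ -zE.
  apply: perspective_h_le => //; first by rewrite (ltW c0).
  by apply: mu_mono; rewrite ij /= -ltnS.
- move=> i iJ; apply: ereal_sup_ubound; exists (raise_rate mu i eps).
    exact: raise_rate_alternative.
  by rewrite poisson_law_raise_rate EcE.
Qed.

End main.

Theorem theorem2 (R : realType) (eta : R) (eta01 : 0 < eta < 1) :
  exists2 c : R, 0 < c &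
    forall (p : nat) (mu : 'rV[R]_p),
      (1 <= p)%N ->
      (forall i j : 'I_p, (i <= j)%N -> mu ord0 j <= mu ord0 i) ->
      (forall j : 'I_p, 0 < mu ord0 j) ->
      1 <= critical_radius mu ->
      (eta%:E <= minimax_risk (c * critical_radius mu) mu)%E.
Proof.
have /andP[eta0 eta1] := eta01.
have d0 : 0 < 8 * expR 2 + 4 :> R by have := expR_gt0 (2 : R); lra.
have q0 : 0 < 1 - eta by lra.
(* the smallness condition of sparse_mixture_bound with a = 1 - eta *)
have c0 : 0 < (1 - eta) ^+ 2 / (8 * expR 2 + 4).
  by rewrite divr_gt0 ?exprn_gt0.
exists ((1 - eta) ^+ 2 / (8 * expR 2 + 4)) => // p mu p0 mu_mono mu0 _.
apply: minimax_risk_ge => //; last by rewrite mulrC divfK// gt_eqF.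
rewrite c0 ler_pdivrMr// mul1r.
have := expR_gt0 (2 : R); nra.
Qed.
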